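(* Let $X$ be an SDL space, let $\kappa$ be an infinite cardinal with $t(X)\leq\kappa$, and let $F$ be a closed subset of $X$. Suppose that $\mathcal U$ is an open cover of $F$ (a family of open subsets of $X$ whose union contains $F$) and $$\mathcal U=\bigcup_{i\in I}\mathcal U_i,\qquad |I|\leq\kappa.$$ Then, for each $i\in I$, there is a family $\mathcal V_i\in[\mathcal U_i]^{\leq\kappa}$ such that $$F\subseteq\bigcup_{i\in I}\overline{\bigcup\mathcal V_i}.$$
   Context: No separation axiom is assumed on $X$. Closures are taken in $X$. $[A]^{\leq\kappa}$ denotes the family of all subsets of $A$ of cardinality at most $\kappa$. A space is Lindelöf if every open cover has a countable subcover (no separation axiom is included). Strongly discrete: a subset $D$ of a topological space $X$ is strongly discrete if there is a family $\{W_d:d\in D\}$ of pairwise disjoint open subsets of $X$ (indexed by $D$) with $d\in W_d$ for every $d\in D$. SDL space: $X$ is an SDL space if the closure $\overline{D}$ in $X$ is Lindelöf for every strongly discrete subset $D$ of $X$. Tightness: for $x\in X$, $t(x,X)$ is the least infinite cardinal $\lambda$ such that whenever $A\subseteq X$ and $x\in\overline{A}$, there is $B\subseteq A$ with $|B|\leq\lambda$ and $x\in\overline{B}$; $t(X)=\sup\{t(x,X):x\in X\}$ (taken to be an infinite cardinal). *)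

(* Defs.v *)
From mathcomp Require Import all_boot all_order.
From mathcomp Require Import boolp classical_sets functions cardinality topology.

Set Implicit Arguments.
Unset Strict Implicit.
Unset Printing Implicit Defensive.

Local Open Scope classical_set_scope.
Local Open Scope card_scope.

(* A cardinal is represented by any set [K : set T] (over an arbitrary type [T])
   of that cardinality; cardinals are compared with [#<=]. *)

Definition lindelof_space (Y : topologicalType) : Prop :=
  forall U : set (set Y),
    (forall u, U u -> open u) -> \bigcup_(u in U) u = [set: Y] ->
    exists V : set (set Y),
      [/\ V `<=` U, countable V & \bigcup_(v in V) v = [set: Y]].

Definition strongly_discrete (X : topologicalType) (D : set X) : Prop :=
  exists W : X -> set X,
    [/\ forall d, D d -> open (W d), forall d, D d -> W d d & trivIset D W].

(* [set_type A] carries the subspace topology, unlike [subspace A], in which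
   the points outside [A] are kept as isolated points. *)
Definition SDL (X : topologicalType) : Prop :=
  forall D : set X, strongly_discrete D -> lindelof_space (set_type (closure D)).

Definition tight_at (X : topologicalType) (x : X) (T : Type) (K : set T) : Prop :=
  forall A : set X, closure A x ->
    exists B : set X, [/\ B `<=` A, B #<= K & closure B x].

(* t(x, X) = |K| *)
Definition is_tightness_at (X : topologicalType) (x : X) (T : Type) (K : set T)
    : Prop :=
  [/\ infinite_set K, tight_at x K &
      forall (S : Type) (L : set S),
        infinite_set L -> tight_at x L -> K #<= L].

(* |K| is an upper bound of the cardinals t(x, X), for x in X *)
Definition tightness_ub (X : topologicalType) (T : Type) (K : set T) : Prop :=
  forall x : X, exists (S : Type) (L : set S), is_tightness_at x L /\ L #<= K.

(* t(X) = |K|: the supremum, taken among the infinite cardinals *)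
Definition is_tightness (X : topologicalType) (T : Type) (K : set T) : Prop :=
  [/\ infinite_set K, tightness_ub X K &
      forall (S : Type) (L : set S),
        infinite_set L -> tightness_ub X L -> K #<= L].

(* t(X) <= |K| *)
Definition tightness_le (X : topologicalType) (T : Type) (K : set T) : Prop :=
  exists (S : Type) (L : set S), is_tightness X L /\ L #<= K.

(* Main.v *)
Require Import Defs.
From mathcomp Require Import all_boot all_order.
From mathcomp Require wochoice.
From mathcomp Require Import boolp classical_sets functions cardinality topology.

Set Implicit Arguments.
Unset Strict Implicit.
Unset Printing Implicit Defensive.

Local Open Scope classical_set_scope.
Local Open Scope card_scope.

(** Well-order X and run through the points of F, keeping a point x exactly
    when it is not yet in the union of the closures of the unions of the families
    built from the points kept before x.  For a set A of kept points, the i-th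
    family [selected_family A i] consists of

    - for each kept point y of colour i, a chosen member [nb y] of U_i around y
      (the colour [idx y] being some index for which there is one), and
    - for each kept y and each colour j, the members belonging to U_i of a
      countable subcover, taken from U, of the closure of the kept points of
      colour j below y.

    If the set D of kept points satisfies |D| <= |K|, then the families built
    from D are as wanted: a kept point x lies in [nb x], and a rejected point was
    rejected because it already lies in the closures
    ([selected_closure_cover], [card_selected_family]).

    So the heart of the matter is [card_selected].  Points of one colour i are
    strongly discrete: when x is kept, the part of [nb x] outside the closure of
    the union of the i-th family is a neighbourhood of x that misses [nb y] for
    all earlier y of colour i ([strongly_discrete_color]).  Closures of such sets
    are Lindelof, so the countable subcovers used above do exist.  If |D| > |K|,
    cut D down to an initial segment G of size the successor of |K|, and pick a
    colour j whose class H in G still has size > |K|.  Since t(X) <= |K| and the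
    subsets of G of size <= |K| are bounded by points of H, the closure of H is
    covered by the countable subcovers attached to the points of G.  It is
    Lindelof, so countably many members v_n of them suffice; each v_n is attached
    to some y_n in G, and some h in H is above all y_n.  But h, being kept, lies
    outside every v_n, although the v_n cover H.

    The cardinal arithmetic needed is that a union of at most |K| sets of size at
    most |K| has size at most |K| ([card_le_bigcup]); it rests on
    |K x K x nat| <= |K|, proved by Zorn's lemma ([infinite_absorbing]). *)

(** * Cardinal arithmetic *)

(** An injection may be given as a relation, total on A and with inverse
    functional: this avoids both choosing values and supplying default values
    outside A. *)
Lemma card_le_relP T U (A : set T) (B : set U) :
  A #<= B <-> exists R : T -> U -> Prop,
    (forall a, A a -> exists2 b, B b & R a b) /\
    (forall a a' b, A a -> A a' -> R a b -> R a' b -> a = a').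
Proof.
split=> [/card_leP[f]|[R [Rtot Rinj]]].
  exists (fun a b => exists x : A, val x = a /\ val (f x) = b); split.
    move=> a Aa; exists (val (f (SigSub (mem_set Aa)))); first exact: set_valP.
    by exists (SigSub (mem_set Aa)).
  move=> _ _ b _ _ [x [<- xb]] [y [<- yb]]; congr val.
  by apply: (inj (f := f)); rewrite ?in_setT//; apply: val_inj; rewrite xb yb.
have /choice[g gR] (x : A) : exists y : B, R (val x) (val y).
  have [b Bb Rb] := Rtot _ (set_valP x).
  by exists (SigSub (mem_set Bb)).
have ginj : {in [set: A] &, injective g}.
  move=> x y _ _ gxy; apply: val_inj; apply: (Rinj _ _ (val (g x))).
  - exact: set_valP.
  - exact: set_valP.
  - exact: gR.
  - by rewrite gxy; apply: gR.
rewrite -(card_le_eql (card_setT A)) -(card_le_eqr (card_setT B)).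
by rewrite -(card_le_eql (inj_card_eq ginj)) subset_card_le.
Qed.

Lemma card_le_setX T T' U U' (A : set T) (A' : set T') (B : set U) (B' : set U') :
  A #<= A' -> B #<= B' -> A `*` B #<= A' `*` B'.
Proof.
move=> /card_le_relP[R [Rt Ri]] /card_le_relP[S [St Si]]; apply/card_le_relP.
exists (fun p q => R p.1 q.1 /\ S p.2 q.2); split=> [[a b] [/= Aa Bb]|].
  have [a' Aa' Ra'] := Rt _ Aa; have [b' Bb' Sb'] := St _ Bb.
  by exists (a', b').
move=> [a b] [a' b'] [c d] /= [Aa Bb] [Aa' Bb'] [Rac Sbd] [Ra'c Sb'd].
by rewrite (Ri _ _ _ Aa Aa' Rac Ra'c) (Si _ _ _ Bb Bb' Sbd Sb'd).
Qed.

(** A maximal partial bijection between A and B has domain A or range B, since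
    otherwise one more pair could be added. *)
Lemma card_le_total T U (A : set T) (B : set U) : A #<= B \/ B #<= A.
Proof.
pose P (G : set (T * U)) := [/\ G `<=` A `*` B,
  forall a b b', G (a, b) -> G (a, b') -> b = b' &
  forall a a' b, G (a, b) -> G (a', b) -> a = a'].
have [|G [[GAB Gfun Ginj] Gmax]] := @Zorn_bigcup _ P.
  move=> F FP Ftot; have two p q : (\bigcup_(X in F) X) p ->
      (\bigcup_(X in F) X) q -> exists2 X, F X & X p /\ X q.
    move=> [X FX Xp] [Y FY Yq].
    by have [XY|YX] := Ftot _ _ FX FY; [exists Y | exists X] => //;
       split=> //; [apply: XY | apply: YX].
  split.
  - by move=> p [X /FP[XAB _ _] /XAB].
  - by move=> a b b' /two /[apply] -[X /FP[_ h _] [+ +]]; apply: h.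
  - by move=> a a' b /two /[apply] -[X /FP[_ _ h] [+ +]]; apply: h.
have [totA|] := pselect (forall a, A a -> exists b, G (a, b)).
  left; apply/card_le_relP; exists (fun a b => G (a, b)).
  split=> [a /totA[b Gab]|a a' b _ _]; last exact: Ginj.
  by exists b => //; have [] := GAB _ Gab.
move=> /existsNP[a /not_implyP[Aa /forallNP Ga]].
have [totB|] := pselect (forall b, B b -> exists a, G (a, b)).
  right; apply/card_le_relP; exists (fun b a => G (a, b)).
  split=> [b /totB[a' Gab]|b b' a' _ _]; last exact: Gfun.
  by exists a' => //; have [] := GAB _ Gab.
move=> /existsNP[b /not_implyP[Bb /forallNP Gb]].
case: (Gmax (G `|` [set (a, b)])).
  split; first exact: subsetUl.
  by move=> /(_ (a, b)) h; apply: (Ga b); apply: h; right.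
split.
- by move=> p [/GAB//|->].
- move=> x y y' [Gxy|xy] [Gxy'|xy'].
  + exact: Gfun Gxy Gxy'.
  + by case: xy' Gxy => -> _ /Ga.
  + by case: xy Gxy' => -> _ /Ga.
  + by case: xy xy' => _ -> [_ ->].
- move=> x x' y [Gxy|xy] [Gxy'|xy'].
  + exact: Ginj Gxy Gxy'.
  + by case: xy' Gxy => _ -> /Gb.
  + by case: xy Gxy' => _ -> /Gb.
  + by case: xy xy' => -> _ [-> _].
Qed.

(** The factor nat is harmless for infinite A, and it makes every nonempty
    absorbing set infinite, so that the empty set can serve as the starting point
    of the Zorn argument below. *)
Definition absorbing T (A : set T) := A `*` A `*` [set: nat] #<= A.

(** The labels 0 and 1 in nat keep the copies of A and B apart. *)
Lemma absorbing_setU T (A B : set T) :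
  absorbing A -> A !=set0 -> B #<= A -> A `|` B #<= A.
Proof.
move=> sqA [a0 Aa0] /card_le_relP[R [Rt Ri]]; apply: card_le_trans sqA.
apply/card_le_relP; exists (fun x p => (A x /\ p = (x, x, 0)) \/
  [/\ ~ A x, B x, R x p.1.1 & p = (p.1.1, p.1.1, 1)]).
split=> [x|x x' [[p q] n] _ _].
  have [Ax _|nAx [//|Bx]] := pselect (A x).
    by exists (x, x, 0) => //; left.
  by have [y Ay Rxy] := Rt _ Bx; exists (y, y, 1) => //; right.
move=> [[Ax [<- _ n0]]|[nAx Bx Rx [_ n1]]] [[Ax' []]|[nAx' Bx' Rx' []]] //=.
- by move=> _ n0'; rewrite n0' in n0.
- by rewrite n1.
- by move=> _ _; apply: Ri Rx Rx'.
Qed.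

(** Zorn's lemma is applied to the relations G that witness, in the sense of
    [card_le_relP], that a subset A of K is absorbing; A is recovered from G as
    [field G].  For a maximal G, either K \ A embeds in A, and then |K| <= |A|; or
    K \ A contains a copy B of A (a copy of nat if A is empty), and then the union
    of A and B embeds its triples into B, which extends G.  Since G takes its
    values in A, disjoint from B, the extension still has a functional inverse. *)
Lemma infinite_absorbing T (K : set T) : infinite_set K -> absorbing K.
Proof.
move=> /infiniteP Kinf.
pose field (G : set (T * T * nat * T)) a := exists c, G (a, a, 0, c).
pose P (G : set (T * T * nat * T)) := [/\ field G `<=` K,
  forall a b n, field G a -> field G b -> exists c, G (a, b, n, c),
  forall p c, G (p, c) -> field G c &
  forall p p' c, G (p, c) -> G (p', c) -> p = p'].
have [|G [[GK Gtot Gran Ginj] Gmax]] := @Zorn_bigcup _ P.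
  move=> F FP Ftot.
  have sub X a : F X -> field X a -> field (\bigcup_(X in F) X) a.
    by move=> FX [c Xc]; exists c, X.
  split.
  - by move=> a [c [X FX Xc]]; have [XK _ _ _] := FP _ FX; apply: XK; exists c.
  - move=> a b n [c [X FX Xc]] [d [Y FY Yd]].
    have [Z FZ [Zc Zd]] : exists2 Z, F Z & Z (a, a, 0, c) /\ Z (b, b, 0, d).
      by have [XY|YX] := Ftot _ _ FX FY; [exists Y | exists X] => //;
         split=> //; [apply: XY | apply: YX].
    have [_ Ztot _ _] := FP _ FZ.
    have [||e Ze] := Ztot a b n; [by exists c | by exists d | by exists e, Z].
  - by move=> p c [X FX Xpc]; have [_ _ /(_ _ _ Xpc)/(sub _ _ FX)] := FP _ FX.
  - move=> p p' c [X FX Xp] [Y FY Yp'].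
    have [XY|YX] := Ftot _ _ FX FY.
      by have [_ _ _ inj] := FP _ FY; apply: inj Yp'; apply: XY Xp.
    by have [_ _ _ inj] := FP _ FX; apply: inj Xp _; apply: YX Yp'.
set A := field G in GK Gtot Gran.
have sqA : absorbing A.
  apply/card_le_relP; exists (fun p c => G (p, c)); split=> [[[a b] n] [[/= Aa Ab] _]|].
    by have [c Gc] := Gtot _ _ n Aa Ab; exists c => //; apply: Gran Gc.
  by move=> p p' c _ _; apply: Ginj.
have noext B : B `<=` K `\` A -> B !=set0 ->
    ~ ((A `|` B) `*` (A `|` B) `*` [set: nat] #<= B).
  move=> BKA [b0 Bb0] /card_le_relP[R [Rt Ri]].
  pose C := A `|` B; pose H : set (T * T * nat * T) :=
    [set q | [/\ C q.1.1.1, C q.1.1.2, B q.2 & R q.1 q.2]].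
  have BnA b : B b -> ~ A b by move=> /BKA[].
  have fH a : field (G `|` H) a <-> C a.
    split=> [[c [Gc|[]//]]|Ca]; first by left; exists c.
    by have [//|c Bc Rc] := Rt (a, a, 0); exists c; right.
  apply: (Gmax (G `|` H)).
    split; first exact: subsetUl.
    move=> HG; apply: (BnA _ Bb0).
    have /fH[c Hc] : C b0 by right.
    by exists c; apply: HG.
  split.
  - by move=> a /fH[/GK//|/BKA[]].
  - move=> a b n /fH Ca /fH Cb.
    by have [//|c Bc Rc] := Rt (a, b, n); exists c; right.
  - by move=> p c [/Gran Ac|[_ _ Bc _]]; apply/fH; [left|right].
  - move=> p p' c [Gp|[/= C1 C2 Bc Rp]] [Gp'|[/= C1' C2' Bc' Rp']].
    + exact: Ginj Gp Gp'.
    + by case: (BnA _ Bc' (Gran _ _ Gp)).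
    + by case: (BnA _ Bc (Gran _ _ Gp')).
    + by apply: Ri Rp Rp'.
(* [noext] is now contradicted unless K \ A embeds in A *)
have [A0|/set0P Ane] := eqVneq A set0.
  have /card_subP[B BN BK] := Kinf.
  case: (noext B); rewrite ?A0 ?setD0 ?set0U//.
    apply/set0P/eqP => B0; move: BN; rewrite B0 card_eq_sym card_eq0.
    by move=> /eqP/seteqP[/(_ 0 I)].
  have [BleN NB] := (card_eqPle _ _).1 BN.
  apply: card_le_trans NB; apply: card_le_trans (_ : [set: nat * nat * nat] #<= _).
    rewrite -(_ : setT `*` setT `*` setT = [set: nat * nat * nat]).
      by apply: card_le_setX => //; apply: card_le_setX.
    by apply/seteqP; split.
  exact: countableP.
have [KA|AK] := card_le_total (K `\` A) A.
  have KleA : K #<= A.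
    apply: card_le_trans (absorbing_setU sqA Ane KA).
    by apply: subset_card_le => x Kx; have [|] := pselect (A x); [left|right].
  apply: card_le_trans (card_le_trans sqA _); last exact: subset_card_le.
  by apply: card_le_setX => //; apply: card_le_setX.
have /card_subP[B BA BK] := AK.
have [BleA AB] := (card_eqPle _ _).1 BA.
case: (noext B) => //.
  by apply/set0P/eqP => B0; move: Ane AB => /set0P; rewrite B0 card_le0 => /negP.
have UA : A `|` B #<= A := absorbing_setU sqA Ane BleA.
apply: card_le_trans AB; apply: card_le_trans sqA.
by apply: card_le_setX => //; apply: card_le_setX.
Qed.

Lemma card_le_bigcup T I U (K : set T) (D : set I) (F : I -> set U) :
  infinite_set K -> D #<= K -> (forall i, D i -> F i #<= K) ->
  \bigcup_(i in D) F i #<= K.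
Proof.
move=> Kinf /card_le_relP[R [Rt Ri]] FK.
have /choice[S Sp] i : exists S : U -> T -> Prop, D i ->
    (forall a, F i a -> exists2 b, K b & S a b) /\
    (forall a a' b, F i a -> F i a' -> S a b -> S a' b -> a = a').
  have [Di|nDi] := pselect (D i); last by exists (fun _ _ => True).
  by have /card_le_relP[S ?] := FK _ Di; exists S.
apply: card_le_trans (infinite_absorbing Kinf); apply/card_le_relP.
exists (fun u p => exists i, [/\ D i, F i u, R i p.1.1 & S i u p.1.2] /\ p.2 = 0).
split=> [u [i Di Fiu]|u u' [[p q] n] _ _].
  have [p Kp Rp] := Rt _ Di; have [/(_ _ Fiu)[q Kq Sq] _] := Sp _ Di.
  by exists (p, q, 0) => //; exists i.
move=> [i [[Di Fu /= Rip Siq] _]] [j [[Dj Fu' /= Rjp Sjq] _]].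
have ij := Ri _ _ _ Di Dj Rip Rjp; rewrite -ij in Fu' Sjq.
by have [_ inj] := Sp _ Di; apply: inj Siq Sjq.
Qed.

Lemma card_leU T U (K : set T) (A B : set U) :
  infinite_set K -> A #<= K -> B #<= K -> A `|` B #<= K.
Proof.
move=> Kinf AK BK; rewrite -[A `|` B]bigcup2E.
apply: card_le_bigcup => //; first exact/infiniteP.
by move=> [|[|i]] _ //=; apply: card_ge0.
Qed.

(** * Well-orderings and selection *)

Lemma exists_well_order (T : choiceType) : exists lt : T -> T -> Prop,
  [/\ well_founded lt, forall x y, [\/ lt x y, x = y | lt y x] &
      forall x y z, lt x y -> lt y z -> lt x z].
Proof.
have [R Rwo] := wochoice.well_ordering_principle T.
have Rmin (A : set T) : A !=set0 -> exists2 z, A z & forall y, A y -> R z y.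
  move=> [x Ax]; have [|z [[zA zmin] _]] := Rwo [pred x | `[< A x >]].
    by exists x; apply/asboolP.
  by exists z; [exact/asboolP|move=> y Ay; apply: zmin; exact/asboolP].
have Rwoc : wochoice.wo_chain R {: T} by move=> A _; apply: Rwo.
have Ranti x y : R x y -> R y x -> x = y.
  by move=> xy yx; apply: (wochoice.wo_chain_antisymmetric Rwoc) => //; apply/andP.
pose lt x y := ~ R y x.
have ltR x y : lt x y -> R x y.
  by move=> /negP nyx; have := wochoice.wo_chainW Rwoc (x := x) (y := y) isT isT;
     rewrite (negbTE nyx) orbF.
exists lt; split.
- move=> x; apply: contrapT => nx.
  have [z nz zmin] := Rmin [set x | ~ Acc lt x] (ex_intro _ x nx).
  by apply: nz; constructor=> y yz; apply: contrapT => /zmin.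
- move=> x y; have [yx|] := boolP (R y x); last by move/negP; constructor 1.
  have [xy|] := boolP (R x y); last by move/negP; constructor 3.
  by constructor 2; apply: Ranti.
- move=> x y z xy yz zx.
  have [|w [[|]|] -> wmin] := Rmin [set x; y; z]; first by exists z; right.
  + by apply: yz; rewrite -[z](Ranti x z)//; [apply/ltR|apply: wmin; right].
  + by apply: xy; apply: wmin; left; left.
  + by apply: yz; apply: wmin; left; right.
Qed.

(** Membership of x in D may be prescribed in terms of the part of D below x:
    this is well-founded recursion with values in Prop. *)
Lemma wf_selection (T : Type) (lt : T -> T -> Prop) (P : set T -> T -> Prop) :
  well_founded lt ->
  exists D : set T, forall x, D x <-> P (D `&` [set y | lt y x]) x.
Proof.
move=> wf.
pose step x (rec : forall y, lt y x -> Prop) : Prop :=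
  P [set y | exists yx : lt y x, rec y yx] x.
exists (Fix wf (fun _ => Prop) step) => x.
rewrite [X in X <-> _]Fix_eq /step; last first.
  move=> y f g fg; congr P; apply/predeqP => z.
  by split=> -[zy h]; exists zy; rewrite ?fg// -fg.
set D := Fix _ _ _.
suff -> : [set y | exists _ : lt y x, D y] = D `&` [set y | lt y x] by [].
by apply/predeqP => y; split=> [[yx Dy]|[Dy yx]]; [split|exists yx].
Qed.

(** * Sets larger than K *)

Section LargeSets.
Variables (T S I : Type) (K : set S).
Hypothesis Kinf : infinite_set K.
Variable lt : T -> T -> Prop.
Hypothesis lt_wf : well_founded lt.
Hypothesis lt_total : forall x y, [\/ lt x y, x = y | lt y x].
Implicit Types (D G : set T).

(** The points of D with at most |K| predecessors in D form an initial segment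
    of D, of order type the successor cardinal of |K|.  If it had size <= |K|, then by induction every point of D
    would be in it. *)
Lemma exists_successor_segment D : ~ (D #<= K) -> exists G : set T,
  [/\ G `<=` D, ~ (G #<= K) & forall x, G x -> D `&` [set y | lt y x] #<= K].
Proof.
move=> DK; pose G := [set x | D x /\ D `&` [set y | lt y x] #<= K].
exists G; split=> [x []//|GK|x []//].
have DG x : D x -> G x.
  elim/(well_founded_ind lt_wf): x => x IH Dx; split=> //.
  by apply: card_le_trans GK; apply: subset_card_le => y [Dy yx]; apply: IH.
by apply: DK; apply: card_le_trans GK; apply: subset_card_le.
Qed.

(** Regularity of the successor cardinal: if no point of H were above all of B,
    then H would be covered by |B| <= |K| segments of size <= |K|. *)
Lemma successor_cofinal D G (H B : set T) :
  (forall x, G x -> D `&` [set y | lt y x] #<= K) -> G `<=` D ->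
  H `<=` G -> ~ (H #<= K) -> B `<=` G -> B #<= K ->
  exists2 h, H h & forall b, B b -> lt b h.
Proof.
move=> segK GD HG HK BG BK; apply: contrapT => nh; apply: HK.
apply: (@card_le_trans _ _ _
    (\bigcup_(b in B) (D `&` [set y | lt y b] `|` [set b]))).
  apply: subset_card_le => h Hh; apply: contrapT => nb; apply: nh.
  exists h => // b Bb; have [//|bh|hb] := lt_total b h.
    by case: nb; exists b => //; right.
  by case: nb; exists b => //; left; split=> //; apply/GD/HG.
apply: card_le_bigcup => // b Bb; apply: card_leU => //; first exact/segK/BG.
by apply: card_le_trans ((infiniteP _).1 Kinf); exact: countable1.
Qed.

Lemma pigeonhole_large G (f : T -> I) : [set: I] #<= K -> ~ (G #<= K) ->
  exists i, ~ (G `&` f @^-1` [set i] #<= K).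
Proof.
move=> IK GK; apply: contrapT => /forallNP small; apply: GK.
apply: (@card_le_trans _ _ _ (\bigcup_i (G `&` f @^-1` [set i]))).
  by apply: subset_card_le => x Gx; exists (f x).
by apply: card_le_bigcup => // i _; apply: contrapT; apply: small.
Qed.

End LargeSets.

(** * Topological preliminaries *)

Lemma lindelof_subcover (X : topologicalType) (A : set X) (V : set (set X)) :
  lindelof_space (set_type A) -> (forall v, V v -> open v) ->
  A `<=` \bigcup_(v in V) v ->
  exists C, [/\ C `<=` V, countable C & A `<=` \bigcup_(v in C) v].
Proof.
move=> lindA Vo AV.
pose tr (v : set X) : set (set_type A) := [set a | v (val a)].
have [|| W [WV Wc Wcov]] := lindA (tr @` V).
- by move=> _ [v Vv <-]; exists v; first exact: Vo.
- apply/seteqP; split=> // a _; have [v Vv va] := AV _ (set_valP a).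
  by exists (tr v) => //; exists v.
have /choice[c cP] w : exists v, W w -> V v /\ tr v = w.
  have [/WV[v Vv vw]|nWw] := pselect (W w); last by exists set0.
  by exists v.
exists (c @` W); split.
- by move=> _ [w /cP[Vc _] <-].
- exact: card_le_trans (card_image_le _ _) Wc.
- move=> x Ax; have : [set: set_type A] (SigSub (mem_set Ax)) by [].
  rewrite -Wcov => -[w Ww wx]; exists (c w); first by exists w.
  by have [_ tw] := cP _ Ww; rewrite -tw in wx.
Qed.

Lemma tightness_le_tight (X : topologicalType) (T : Type) (K : set T) (x : X) :
  tightness_le X K -> tight_at x K.
Proof.
move=> [S [L [[_ ubL _] LK]]] A.
have [S' [M [[_ tightM _] ML]]] := ubL x.
move=> /tightM[B [BA BM Bx]]; exists B; split=> //.
exact: card_le_trans (card_le_trans ML LK).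
Qed.

(** * The greedy selection *)

Section GreedySelection.
Variables (X : topologicalType) (S I : Type) (K : set S).
Variables (F : set X) (U : set (set X)) (U_ : I -> set (set X)).
Hypothesis Kinf : infinite_set K.
Hypothesis IK : [set: I] #<= K.
Hypothesis U_open : forall u, U u -> open u.
Hypothesis U_union : U = \bigcup_i U_ i.

Variable lt : X -> X -> Prop.
Hypothesis lt_wf : well_founded lt.
Hypothesis lt_total : forall x y, [\/ lt x y, x = y | lt y x].
Hypothesis lt_trans : forall x y z, lt x y -> lt y z -> lt x z.

Variables (nb : X -> set X) (idx : X -> I).
Hypothesis nbP : forall x, F x -> U_ (idx x) (nb x) /\ nb x x.

Variable cov : set X -> set (set X).
Hypothesis covU : forall A, cov A `<=` U.
Hypothesis cov_countable : forall A, countable (cov A).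
Hypothesis covP : forall A,
  (exists C, [/\ C `<=` U, countable C & A `<=` \bigcup_(v in C) v]) ->
  A `<=` \bigcup_(v in cov A) v.

Notation below A y := (A `&` [set z | lt z y]).
Notation color A i := (A `&` idx @^-1` [set i]).

Definition selected_family (A : set X) (i : I) : set (set X) :=
  nb @` color A i `|`
  \bigcup_(y in A) \bigcup_j (cov (closure (color (below A y) j)) `&` U_ i).

Definition selected_closure (A : set X) : set X :=
  \bigcup_i closure (\bigcup_(v in selected_family A i) v).

Lemma selected_family_sub A i : A `<=` F -> selected_family A i `<=` U_ i.
Proof.
by move=> AF v [[x [Ax <-] <-]|[y _ [j _ []]]//]; have [] := nbP (AF _ Ax).
Qed.

Lemma card_selected_family A i : A #<= K -> selected_family A i #<= K.
Proof.
move=> AK; apply: card_leU => //.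
  apply: (card_le_trans (card_image_le _ _)).
  by apply: card_le_trans AK; apply: subset_card_le => x [].
apply: card_le_bigcup => // y Ay; apply: card_le_bigcup => // j _.
apply: card_le_trans ((infiniteP _).1 Kinf).
apply: (card_le_trans _ (cov_countable (closure (color (below A y) j)))).
by apply: subset_card_le => v [].
Qed.

Lemma below_below A x y : lt y x -> below (below A x) y = below A y.
Proof.
move=> yx; apply/predeqP => z; split=> [[[]]//|[Az zy]].
by split=> //; split=> //; apply: lt_trans yx.
Qed.

Lemma selected_family_below A x i :
  selected_family (below A x) i `<=` selected_family A i.
Proof.
move=> v [[y [[Ay _] yi] <-]|[y [Ay yx] [j _]]]; first by left; exists y.
by rewrite below_below// => vcov; right; exists y => //; exists j.
Qed.

Variable D : set X.
Hypothesis DP : forall x, D x <-> F x /\ ~ selected_closure (below D x) x.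

Lemma selected_sub : D `<=` F. Proof. by move=> x /DP[]. Qed.

Lemma selected_closure_cover : F `<=` selected_closure D.
Proof.
move=> x Fx; have [Dx|nDx] := pselect (D x).
  have [Unb nbx] := nbP Fx; exists (idx x) => //; apply: subset_closure.
  by exists (nb x) => //; left; exists x.
have [i _ xi] : selected_closure (below D x) x.
  by apply: contrapT => nx; apply/nDx/DP.
exists i => //; apply: closure_subset xi => z [v Vv vz].
by exists v => //; apply: selected_family_below Vv.
Qed.

(** For y below x of the same colour i, [nb y] belongs to the i-th family at the
    stage of x, so removing the closure of the union of that family from [nb x]
    makes the neighbourhoods disjoint. *)
Lemma strongly_discrete_color A i : A `<=` D -> strongly_discrete (color A i).
Proof.
move=> AD.
pose W x := nb x `\` closure (\bigcup_(v in selected_family (below D x) i) v).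
have WW x y z : color A i x -> color A i y -> lt x y -> W x z -> W y z -> False.
  move=> [/AD Dx xi] [_ _] xy [nbz _] [_]; apply; apply: subset_closure.
  by exists (nb x) => //; left; exists x.
exists W; split=> [x [/AD Dx xi]|x [/AD Dx xi]|x y Ax Ay [z [Wx Wy]]].
- have [Unb nbx] := nbP (selected_sub Dx).
  rewrite /W setDE; apply: openI; last exact/closed_openC/closed_closure.
  by apply: U_open; rewrite U_union; exists (idx x).
- have [Unb nbx] := nbP (selected_sub Dx); split=> // clx.
  by have /DP[_] := Dx; apply; exists i.
- by have [xy|//|yx] := lt_total x y; [have := WW x y z | have := WW y x z];
    move=> h; case: h.
Qed.

Hypothesis X_SDL : SDL X.
Hypothesis F_closed : closed F.
Hypothesis FU : F `<=` \bigcup_(u in U) u.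
Hypothesis tightK : forall x : X, tight_at x K.

Lemma lindelof_color A i (V : set (set X)) : A `<=` D ->
  (forall v, V v -> open v) -> closure (color A i) `<=` \bigcup_(v in V) v ->
  exists C, [/\ C `<=` V, countable C &
                closure (color A i) `<=` \bigcup_(v in C) v].
Proof.
by move=> AD; apply/lindelof_subcover/X_SDL/strongly_discrete_color.
Qed.

Lemma closure_color_sub A i : A `<=` D -> closure (color A i) `<=` F.
Proof.
move=> AD; have /closure_id -> := F_closed.
by apply: closure_subset => x [/AD/selected_sub].
Qed.

Lemma cov_color A i : A `<=` D ->
  closure (color A i) `<=` \bigcup_(v in cov (closure (color A i))) v.
Proof.
move=> AD; apply/covP/lindelof_color => //.
exact: subset_trans (closure_color_sub AD) FU.
Qed.

(** Were D larger than K, a large class H of one colour would have its closure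
    covered by countably many sets, all of them in the families at some stage h
    in H; the point h would then have been rejected. *)
Lemma card_selected : D #<= K.
Proof.
apply: contrapT => DK.
have [G [GD GK Gseg]] := exists_successor_segment lt_wf DK.
have [j] := pigeonhole_large Kinf idx IK GK; set H := color G j => HK.
have HG : H `<=` G by move=> x [].
have belowD y : below D y `<=` D by move=> z [].
pose O := \bigcup_(y in G) cov (closure (color (below D y) j)).
(* [O] covers the closure of H by tightness, as small subsets of H are bounded *)
have [||C [CO Cc Ccov]] := @lindelof_color G j O GD.
- by move=> v [y _ /covU/U_open].
- move=> x /tightK[B [BH BK Bx]].
  have [|g Hg Bg] := successor_cofinal Kinf lt_total Gseg GD HG HK _ BK.
    exact: subset_trans HG.
  have [v cv vx] : (\bigcup_(v in cov (closure (color (below D g) j))) v) x.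
    apply: cov_color => //; apply: closure_subset Bx => b Bb.
    have [Gb bj] := BH _ Bb.
    by split=> //; split; [apply: GD | apply: Bg].
  by exists v => //; exists g => //; apply: HG.
(* [r v] is the stage whose subcover contains v *)
have /choice[r rP] v : exists y, C v ->
    G y /\ cov (closure (color (below D y) j)) v.
  have [/CO[y Gy cv]|nCv] := pselect (C v); first by exists y.
  have [G0|/set0P[x _]] := eqVneq G set0; first by case: GK; rewrite G0 card_ge0.
  by exists x.
have [||h Hh rh] := successor_cofinal (B := r @` C) Kinf lt_total Gseg GD HG HK.
- by move=> _ [v /rP[Gr _] <-].
- apply: (card_le_trans (card_image_le _ _)).
  exact: card_le_trans Cc ((infiniteP _).1 Kinf).
have [v Cv vh] := Ccov h (subset_closure Hh).
have [Grv cv] := rP _ Cv; have rvh := rh _ (imageP r Cv).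
have [i _ Uiv] : (\bigcup_i U_ i) v by rewrite -U_union; apply: covU cv.
have /DP[_] := GD _ (HG _ Hh); apply; exists i => //; apply: subset_closure.
exists v => //; right; exists (r v); first by split=> //; apply: GD.
by exists j => //; rewrite below_below.
Qed.

End GreedySelection.

Theorem lemma3p1 (X : topologicalType) (T : Type) (K : set T) (F : set X)
    (I : Type) (U : set (set X)) (U_ : I -> set (set X)) :
  SDL X -> infinite_set K -> tightness_le X K -> closed F ->
  (forall u, U u -> open u) -> F `<=` \bigcup_(u in U) u ->
  U = \bigcup_i U_ i -> [set: I] #<= K ->
  exists V_ : I -> set (set X),
    (forall i, V_ i `<=` U_ i /\ V_ i #<= K) /\
    F `<=` \bigcup_i closure (\bigcup_(v in V_ i) v).
Proof.
move=> sdlX Kinf tK clF Uo FU UE IK.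
have [F0|/set0P[x0 Fx0]] := eqVneq F set0.
  by exists (fun=> set0); split=> [i|]; [split=> //; exact: card_ge0|rewrite F0].
have [u0 + _] := FU _ Fx0; rewrite UE => -[i0 _ _].
have /choice[p pP] x : exists q : set X * I, F x -> U_ q.2 q.1 /\ q.1 x.
  have [Fx|nFx] := pselect (F x); last by exists (set0, i0).
  by have [u + ux] := FU _ Fx; rewrite UE => -[i _ Uiu]; exists (u, i).
have /choice[cov covP] (A : set X) : exists C : set (set X),
    [/\ C `<=` U, countable C &
      (exists C, [/\ C `<=` U, countable C & A `<=` \bigcup_(v in C) v]) ->
      A `<=` \bigcup_(v in C) v].
  have [[C [CU Cc AC]]|nC] := pselect
      (exists C, [/\ C `<=` U, countable C & A `<=` \bigcup_(v in C) v]).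
    by exists C.
  by exists set0; split=> //; exact: countable0.
have [lt [lt_wf lt_total lt_trans]] := exists_well_order X.
pose nb x := (p x).1; pose idx x := (p x).2.
have nbP x : F x -> U_ (idx x) (nb x) /\ nb x x := pP x.
have [D DP] := wf_selection
  (fun A x => F x /\ ~ selected_closure U_ lt nb idx cov A x) lt_wf.
have DK : D #<= K.
  apply: (card_selected Kinf IK Uo UE lt_wf lt_total lt_trans nbP _ _ DP) => //.
  - by move=> A; have [] := covP A.
  - by move=> A; have [] := covP A.
  - by move=> x; apply: tightness_le_tight.
exists (selected_family U_ lt nb idx cov D); split=> [i|].
  split; first by apply: (selected_family_sub nbP) => x /DP[].
  by apply: card_selected_family => // A; have [] := covP A.
exact: (selected_closure_cover lt_trans nbP DP).
Qed.
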